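(* Let $0<\theta<1$ and $Y_\theta=(\mathcal D(C),\mathcal D(C^2))_{\theta,1}$. Let $t\in[0,T]$ and $E_h(t):=R_h(t)-P_h(t)$. Assume that there is a constant $K>0$ such that for all $0<h\le h_0$ $$\|E_h(t)\|_{\mathcal L(\mathcal D(C),\mathcal E_p)}\le K h,\qquad \|E_h(t)\|_{\mathcal L(\mathcal D(C^2),\mathcal E_p)}\le K h^2 .$$ Then there is a constant $K'>0$ such that for all $0<h\le h_0$ $$\|E_h(t)\|_{\mathcal L(Y_\theta,\mathcal E_p)}\le K' h^{1+\theta}.$$
   Context: Let $X$ be a Banach space, $\tau<0$, $T>0$, $1<p<\infty$, and $\mathcal E_p:=X\oplus L^p([\tau,0];X)$ with norm $\|(u,\rho)\|_{\mathcal E_p}=\|u\|_X+\|\rho\|_{L^p}$. The transport operator is $C(u,\rho):=(0,\partial_\sigma\rho)$ with domain $\mathcal D(C):=\{(u,\rho)\in X\oplus W^{1,p}([\tau,0];X):\rho(0)=u\}$; its resolvent $S_h^C:=(I-hC)^{-1}\in\mathcal L(\mathcal E_p)$ exists for every $h>0$. $\mathcal D(C)$ carries the graph norm $\|x\|_{\mathcal E_p}+\|Cx\|_{\mathcal E_p}$, and $\mathcal D(C^2)=\{x\in\mathcal D(C):Cx\in\mathcal D(C)\}$ carries the norm $\|x\|_{\mathcal E_p}+\|Cx\|_{\mathcal E_p}+\|C^2x\|_{\mathcal E_p}$. $(\cdot,\cdot)_{\theta,1}$ denotes real interpolation. For $t\in[0,T]$ let $D(t):\mathcal D(C)\to\mathcal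 E_p$ be linear and set $H_h(t):=hD(t)S_h^C$. Standing assumption (operational smallness): there are $h_0>0$, $q\in(0,1)$ with $\|H_h(t)\|_{\mathcal L(\mathcal E_p)}\le q$ for all $t\in[0,T]$, $0<h\le h_0$. Then $P_h(t):=(I-H_h(t))^{-1}S_h^C$, and $R_h(t):=(I-h(C+D(t)))^{-1}$ (with $\mathcal D(C+D(t))=\mathcal D(C)$) is assumed to exist in $\mathcal L(\mathcal E_p)$ for $0<h\le h_0$. *)

(* Defs.v *)
From HB Require Import structures.
From mathcomp Require Import all_boot all_order all_algebra.
From mathcomp Require Import generic_quotient ring_quotient.
From mathcomp Require Import all_classical all_reals all_analysis.
From mathcomp Require Import measurable_realfun.

Set Implicit Arguments.
Unset Strict Implicit.
Unset Printing Implicit Defensive.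

Import Order.TTheory GRing.Theory Num.Theory.
Import numFieldTopology.Exports numFieldNormedType.Exports.

Local Open Scope classical_set_scope.
Local Open Scope ring_scope.
Local Open Scope quotient_scope.

Section strong_measurability.
Context {d} {T : measurableType d} {R : realType} {X : normedModType R}.
Implicit Types f s : T -> X.

Definition simple_fun s :=
  finite_set (range s) /\ forall y, measurable (s @^-1` [set y]).

(* Pointwise limit of simple functions (X need not be separable).  Asking for
   convergence everywhere rather than almost everywhere selects representatives
   that need no exceptional null set; the L^p classes below are the same. *)
Definition strongly_measurable f := exists s : (T -> X)^nat,
  (forall n, simple_fun (s n)) /\ (forall x, s ^~ x @ \oo --> f x).

Lemma simple_fun_cst y : simple_fun (cst y).
Proof.
split; first by apply: (sub_finite_set _ (finite_set1 y)) => _ [? _ <-].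
by move=> z; rewrite preimage_cst; case: ifP.
Qed.

Lemma simple_fun_comp2 (op : X -> X -> X) s t :
  simple_fun s -> simple_fun t -> simple_fun (fun x => op (s x) (t x)).
Proof.
move=> [fs ms] [ft mt]; split.
  apply: (sub_finite_set _ (finite_image2 op fs ft)) => _ [x _ <-].
  by exists (s x); [exists x | exists (t x); [exists x|]].
move=> y.
rewrite (_ : _ @^-1` _ = \bigcup_(ab in [set ab | (range s `*` range t) ab /\
   op ab.1 ab.2 = y]) (s @^-1` [set ab.1] `&` t @^-1` [set ab.2])).
  apply: fin_bigcup_measurable; last by move=> ab _; exact: measurableI.
  by apply: (sub_finite_set _ (finite_setX fs ft)) => ab [].
apply/seteqP; split=> [x /= <-|x [[a b] [_ /= <-] [/= -> ->]]] //.
by exists (s x, t x) => //=; split => //; split; exists x.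
Qed.

Lemma simple_fun_measurable_norm s :
  simple_fun s -> measurable_fun setT (fun x => `|s x|).
Proof.
move=> [fs ms] _ B mB; rewrite setTI.
rewrite (_ : _ @^-1` _ = \bigcup_(a in range s `&` [set a | B `|a|])
  (s @^-1` [set a])).
  by apply: fin_bigcup_measurable => //; apply: (sub_finite_set _ fs) => a [].
apply/seteqP; split=> [x /= Bx|x [a [_ /= Ba] /= ->]] //.
by exists (s x) => //; split => //; exists x.
Qed.

Lemma strongly_measurable_comb a f g :
  strongly_measurable f -> strongly_measurable g ->
  strongly_measurable (a *: f + g).
Proof.
move=> [s [ss sf]] [t [tt tg]]; exists (fun n => fun x => a *: s n x + t n x).
split=> [n|x]; first exact: (simple_fun_comp2 (fun u v => a *: u + v)).
by apply: cvgD => //; apply: cvgZ => //; exact: cvg_cst.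
Qed.

Lemma strongly_measurable0 : strongly_measurable (0 : T -> X).
Proof.
exists (fun _ => cst 0); split=> [_|x]; first exact: simple_fun_cst.
exact: cvg_cst.
Qed.

Lemma strongly_measurable_norm f :
  strongly_measurable f -> measurable_fun setT (fun x => `|f x|).
Proof.
move=> [s [ss sf]].
apply: (@measurable_fun_cvg _ _ _ setT (fun n x => `|s n x|)) => //.
  by move=> n; exact: simple_fun_measurable_norm.
by move=> x _; exact: cvg_norm.
Qed.

End strong_measurability.

Section Bochner_Lp_norm.
Context {d} {T : measurableType d} {R : realType} {X : normedModType R}.
Variables (mu : {measure set T -> \bar R}) (p : R).
Implicit Types f g : T -> X.

Definition BLnorm f : \bar R := ('N[mu]_p%:E[EFin \o (fun x => `|f x|%R)])%E.

Lemma BLnorm0 : p != 0 -> BLnorm 0 = 0%E.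
Proof.
move=> p0; rewrite -(Lnorm0 mu (p := p%:E)) ?eqe//.
by apply: eq_Lnorm => x /=; rewrite normr0.
Qed.

Lemma BLnormZ a f : 1 <= p -> strongly_measurable f ->
  (BLnorm (a *: f) = `|a|%:E * BLnorm f)%E.
Proof.
move=> p1 /strongly_measurable_norm mf.
have p0 : p != 0 by rewrite gt_eqF// (lt_le_trans ltr01).
rewrite /BLnorm unlock /Lnorm.
under eq_integral do
    rewrite /= normrZ normrM !normr_id powRM// EFinM.
rewrite ge0_integralZl//; last first.
  apply/measurable_EFinP.
  exact: (@measurableT_comp _ _ _ _ _ _ (@powR R ^~ p)).
rewrite poweRM ?integral_ge0 ?lee_fin ?powR_ge0//.
rewrite poweR_EFin -powRrM mulfV// powRr1//; congr (_ * _ `^ _)%E.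
by apply: eq_integral => x _; rewrite /= normr_id.
Qed.

Let measurable_powR_norm (h : T -> R) : measurable_fun setT h ->
  measurable_fun setT (fun x => (`|(EFin \o h) x| `^ p)%E).
Proof.
move=> mh; apply: (measurableT_comp (measurable_poweR p)).
by apply: measurableT_comp => //; exact/measurable_EFinP.
Qed.

Lemma BLnormD f g : 1 <= p -> strongly_measurable f -> strongly_measurable g ->
  (BLnorm (f + g)%R <= BLnorm f + BLnorm g)%E.
Proof.
move=> p1 mf mg.
have mf' := strongly_measurable_norm mf.
have mg' := strongly_measurable_norm mg.
apply: le_trans (minkowski_EFin mu mf' mg' p1).
have p0 : 0 < p by rewrite (lt_le_trans ltr01).
rewrite /BLnorm unlock /Lnorm.
apply: gt0_ler_poweR; rewrite ?invr_ge0 ?(ltW p0)//.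
- by rewrite in_itv/= leey andbT integral_ge0// => x _; rewrite poweR_ge0.
- by rewrite in_itv/= leey andbT integral_ge0// => x _; rewrite poweR_ge0.
have mfg : measurable_fun setT (fun x => `|(f + g) x|).
  apply: strongly_measurable_norm; rewrite -[f]scale1r.
  exact: strongly_measurable_comb.
apply: ge0_le_integral => //.
- by move=> x _; exact: poweR_ge0.
- exact: measurable_powR_norm.
- by apply: measurable_powR_norm; exact: measurable_funD.
move=> x _; rewrite /= lee_fin ge0_ler_powR ?nnegrE ?(ltW p0)//.
by rewrite !ger0_norm ?addr_ge0// ler_normD.
Qed.

Lemma BLnorm_eq0 f : 1 <= p -> strongly_measurable f ->
  BLnorm f = 0%E -> {ae mu, forall x, f x = 0}.
Proof.
move=> p1 mf /Lnorm_eq0_eq0; have p0 : (0 < p%:E)%E.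
  by rewrite lte_fin (lt_le_trans ltr01).
have /measurable_EFinP mf' := strongly_measurable_norm mf.
move=> /(_ mf' p0); apply: filterS => x /(_ I) [] /eqP.
by rewrite normr_eq0 => /eqP.
Qed.

Lemma ae_eq_BLnorm f g : strongly_measurable f -> strongly_measurable g ->
  {ae mu, forall x, f x = g x} -> BLnorm f = BLnorm g.
Proof.
move=> /strongly_measurable_norm mf /strongly_measurable_norm mg fg.
rewrite /BLnorm unlock /Lnorm; congr (_ `^ _)%E.
apply: ae_eq_integral => //.
- exact: measurable_powR_norm.
- exact: measurable_powR_norm.
- by move: fg; apply: filterS => x /= -> _.
Qed.

End Bochner_Lp_norm.

Section Bochner_Lp.
Context {d} {T : measurableType d} {R : realType} (X : normedModType R).
Variables (mu : {measure set T -> \bar R}) (p : R) (p1 : 1 <= p).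

(* The proof of 1 <= p is a phantom argument, needed for the module instances. *)
Definition BLfun of 1 <= p : {pred T -> X} := fun f =>
  `[< strongly_measurable f /\ (BLnorm mu p f < +oo)%E >].

Lemma BLfunP f : reflect (strongly_measurable f /\ (BLnorm mu p f < +oo)%E)
  (f \in BLfun p1).
Proof. exact: asboolP. Qed.

Lemma BLfun_submod_closed : submod_closed (BLfun p1).
Proof.
have p0 : p != 0 by rewrite gt_eqF// (lt_le_trans ltr01).
split=> [|a f g /BLfunP[mf lf] /BLfunP[mg lg]].
  by apply/BLfunP; rewrite BLnorm0//; split => //; exact: strongly_measurable0.
apply/BLfunP; split; first exact: strongly_measurable_comb.
have maf : strongly_measurable (a *: f).
  rewrite -[_ *: _]addr0.
  by apply: strongly_measurable_comb => //; exact: strongly_measurable0.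
apply: (le_lt_trans (BLnormD mu p1 maf mg)).
by rewrite lte_add_pinfty// BLnormZ// lte_mul_pinfty ?lee_fin.
Qed.

HB.instance Definition _ := GRing.isSubmodClosed.Build _ _ (BLfun p1)
  BLfun_submod_closed.

Record BLfunType := BLfunSub { BLfun_val :> T -> X; _ : BLfun_val \in BLfun p1 }.

HB.instance Definition _ := [isSub for BLfun_val].
HB.instance Definition _ := [Choice of BLfunType by <:].
HB.instance Definition _ := [SubChoice_isSubLmodule of BLfunType by <:].

Implicit Types u v : BLfunType.

Lemma BLfun_meas u : strongly_measurable u.
Proof. by have /BLfunP[] := valP u. Qed.

Lemma BLfun_fin u : BLnorm mu p u \is a fin_num.
Proof.
have /BLfunP[_ lu] := valP u.
by rewrite ge0_fin_numE// Lnorm_ge0.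
Qed.

Definition ae_zero : {pred BLfunType} := fun u =>
  `[< {ae mu, forall x, u x = 0} >].

Lemma ae_zero_submod_closed : submod_closed ae_zero.
Proof.
split=> [|a u v /asboolP u0 /asboolP v0]; first by apply/asboolP; exact: nearW.
apply/asboolP; apply: filterS2 u0 v0 => x ux vx.
by rewrite /= -[LHS]/(a *: u x + v x) ux vx scaler0 addr0.
Qed.

HB.instance Definition _ := GRing.isSubmodClosed.Build _ _ ae_zero
  ae_zero_submod_closed.

Definition Bochner_Lp := {ideal_quot ae_zero}.

HB.instance Definition _ := Choice.on Bochner_Lp.
HB.instance Definition _ := GRing.Zmodule.on Bochner_Lp.
HB.instance Definition _ := EqQuotient.on Bochner_Lp.

Definition Bochner_Lp_fun (f : Bochner_Lp) : BLfunType := repr f.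
Coercion Bochner_Lp_fun : Bochner_Lp >-> BLfunType.

Lemma Bochner_LpP u v :
  \pi_Bochner_Lp u = \pi_Bochner_Lp v <-> {ae mu, forall x, u x = v x}.
Proof.
split=> [/eqP|uv].
  rewrite -(Quotient.idealrBE ae_zero) => /asboolP; apply: filterS => x /eqP.
  by rewrite -[_ x]/(u x - v x) subr_eq0 => /eqP.
apply/eqP; rewrite -(Quotient.idealrBE ae_zero); apply/asboolP.
by apply: filterS uv => x uvx; rewrite -[LHS]/(u x - v x) uvx subrr.
Qed.

Lemma Bochner_Lp_reprK u : {ae mu, forall x, (repr (\pi_Bochner_Lp u)) x = u x}.
Proof. by apply/Bochner_LpP; rewrite reprK. Qed.

Implicit Types f g : Bochner_Lp.

Let scale (a : R) (f : Bochner_Lp) : Bochner_Lp := \pi_Bochner_Lp (a *: repr f).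

Let pi_scale a u : scale a (\pi_Bochner_Lp u) = \pi_Bochner_Lp (a *: u).
Proof.
apply/Bochner_LpP; apply: filterS (Bochner_Lp_reprK u) => x xu.
by rewrite -[LHS]/(a *: (repr (\pi_Bochner_Lp u)) x) xu.
Qed.

Let pi_add u v : \pi_Bochner_Lp u + \pi_Bochner_Lp v = \pi_Bochner_Lp (u + v).
Proof. exact/esym/(Quotient.pi_add ae_zero). Qed.

Let scaleA a b f : scale a (scale b f) = scale (a * b) f.
Proof. by rewrite /scale -/(scale a _) pi_scale scalerA. Qed.

Let scale1 : left_id 1 scale.
Proof. by move=> f; rewrite /scale scale1r reprK. Qed.

Let scaleDr : right_distributive scale +%R.
Proof.
move=> a f g; rewrite -[f]reprK -[g]reprK pi_add !pi_scale pi_add.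
by rewrite scalerDr.
Qed.

Let scaleDl f : {morph scale ^~ f : a b / a + b}.
Proof. by move=> a b; rewrite /scale pi_add scalerDl. Qed.

HB.instance Definition _ := GRing.Zmodule_isLmodule.Build R Bochner_Lp
  scaleA scale1 scaleDr scaleDl.

Lemma pi_Bochner_LpZ a u : a *: \pi_Bochner_Lp u = \pi_Bochner_Lp (a *: u).
Proof. exact: pi_scale. Qed.

Lemma pi_Bochner_LpD u v :
  \pi_Bochner_Lp u + \pi_Bochner_Lp v = \pi_Bochner_Lp (u + v).
Proof. exact: pi_add. Qed.

Let norm (f : Bochner_Lp) : R := fine (BLnorm mu p f).

Let norm_pi u : norm (\pi_Bochner_Lp u) = fine (BLnorm mu p u).
Proof.
congr fine; apply: ae_eq_BLnorm (Bochner_Lp_reprK u); exact: BLfun_meas.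
Qed.

Let ler_normD f g : norm (f + g) <= norm f + norm g.
Proof.
rewrite -[f]reprK -[g]reprK pi_add !norm_pi -lee_fin EFinD !fineK ?BLfun_fin//.
by apply: BLnormD => //; exact: BLfun_meas.
Qed.

Let normZ a f : norm (a *: f) = `|a| * norm f.
Proof.
rewrite -[f]reprK pi_Bochner_LpZ !norm_pi; apply: EFin_inj.
by rewrite EFinM !fineK ?BLfun_fin// -BLnormZ//; exact: BLfun_meas.
Qed.

Let norm0_eq0 f : norm f = 0 -> f = 0.
Proof.
rewrite -[f]reprK norm_pi => f0.
rewrite -[0]reprK; apply/Bochner_LpP.
have f0' : BLnorm mu p (repr f) = 0%E by rewrite -(fineK (BLfun_fin _)) f0.
have h0 : {ae mu, forall x, (repr (0 : Bochner_Lp)) x = 0}.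
  have -> : 0 = \pi_Bochner_Lp 0 by exact: (esym (raddf0 (\pi_({ideal_quot ae_zero})))).
  exact: Bochner_Lp_reprK.
apply: filterS2 (BLnorm_eq0 p1 (BLfun_meas _) f0') h0 => x -> ->.
by [].
Qed.

HB.instance Definition _ := Lmodule_isNormed.Build R Bochner_Lp
  ler_normD normZ norm0_eq0.

Lemma Bochner_Lp_normE (f : Bochner_Lp) : `|f| = fine (BLnorm mu p f).
Proof. by []. Qed.

End Bochner_Lp.

Section Bochner_integral.
Context {d} {T : measurableType d} {R : realType} {X : normedModType R}.
Variable mu : {measure set T -> \bar R}.
Implicit Types f s : T -> X.

Definition simple_integral s : X :=
  \sum_(y \in range s) fine (mu (s @^-1` [set y])) *: y.

Definition Bochner_integral f (v : X) :=
  strongly_measurable f /\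
  exists s : (T -> X)^nat,
    [/\ forall n, simple_fun (s n),
        forall n y, y != 0 -> (mu (s n @^-1` [set y]) < +oo)%E,
        (\int[mu]_x (`|f x - s n x|%R)%:E)%E @[n --> \oo] --> 0%E &
        simple_integral (s n) @[n --> \oo] --> v].

End Bochner_integral.

Section operators.
Context {R : realType} {E : normedModType R}.
Implicit Types (A B : E -> E) (dom : set E) (N : E -> \bar R) (h : R).

(* Partial operators are functions on E together with a domain, and a norm on a
   subspace is a \bar R-valued function on E equal to +oo off that subspace. *)

Definition bounded_operator A := linear A /\ continuous A.

(* norm of A in L((E', N), E), E' being the subspace where N is finite *)
Definition opnorm N A : \bar R :=
  ereal_sup [set `|A x|%:E | x in [set x | (N x <= 1)%E]].

(* junk where A has no preimage in dom *)
Definition inverse_on dom A (y : E) : E := xget 0 [set x | dom x /\ A x = y].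

Definition resolvent dom A h : E -> E := inverse_on dom (fun x => x - h *: A x).

(* I - h A : dom -> E is a bijection whose inverse belongs to L(E) *)
Definition resolvent_exists dom A h :=
  set_bij dom setT (fun x => x - h *: A x) /\ bounded_operator (resolvent dom A h).

Definition linear_on dom A := forall (a : R) x y, dom x -> dom y ->
  A (a *: x + y) = a *: A x + A y.

Definition ambient_norm : E -> \bar R := fun x => `|x|%:E.

Definition graph_norm dom A : E -> \bar R := fun x =>
  if `[< dom x >] then (`|x| + `|A x|)%:E else +oo%E.

Definition domain2 dom A : set E := [set x | dom x /\ dom (A x)].

Definition graph_norm2 dom A : E -> \bar R := fun x =>
  if `[< domain2 dom A x >] then (`|x| + `|A x| + `|A (A x)|)%:E else +oo%E.

(* Peetre K-functional of the couple normed by N0 and N1 *)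
Definition K_functional (N0 N1 : E -> \bar R) (s : R) (x : E) : \bar R :=
  ereal_inf [set (N0 ab.1 + s%:E * N1 ab.2)%E | ab in [set ab | ab.1 + ab.2 = x]].

(* norm of the real interpolation space (X_0, X_1)_{theta,1} *)
Definition interpolation_norm1 (N0 N1 : E -> \bar R) (theta : R) (x : E) : \bar R :=
  (\int[lebesgue_measure]_(s in `]0%R, +oo[)
     ((s `^ (- theta))%:E * K_functional N0 N1 s x * (s^-1)%:E))%E.

End operators.

Section transport.
Context {R : realType} (X : normedModType R) (tau p : R) (p1 : 1 < p).

(* Lebesgue measure on R concentrated on [tau, 0]: elements of L^p([tau, 0]; X)
   are represented by functions on R whose values off [tau, 0] are irrelevant. *)
Definition lebesgue_on : {measure set (measurableTypeR R) -> \bar R} :=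
  mrestr (@lebesgue_measure R)
    (@measurable_itv R `[tau, 0] : measurable (`[tau, 0] : set (measurableTypeR R))).

Local Notation Lp_history := (Bochner_Lp X lebesgue_on (ltW p1)).

(* C^oo functions with compact support in the open interval ]tau, 0[ *)
Definition test_function (phi : R -> R) :=
  (forall n x, derivable (derive1n n phi) x 1) /\
  exists a b, [/\ tau < a, b < 0 & forall x, x \notin `[a, b] -> phi x = 0].

Definition weak_derivative (rho g : Lp_history) := forall phi, test_function phi ->
  exists v,
    Bochner_integral lebesgue_on (fun s => derive1 phi s *: rho s) v /\
    Bochner_integral lebesgue_on (fun s => phi s *: g s) (- v).

Definition W1p : set Lp_history := [set rho | exists g, weak_derivative rho g].

(* the weak derivative; junk off W1p *)
Definition deriv_sigma (rho : Lp_history) : Lp_history :=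
  xget 0 [set g | weak_derivative rho g].

(* rho(0) = u, where rho(0) is the value of the continuous representative *)
Definition trace0 (rho : Lp_history) (u : X) := exists r : R -> X,
  [/\ {within `[tau, 0], continuous r},
      {ae lebesgue_on, forall s, rho s = r s} & r 0 = u].

(* X (+) L^p with the sum norm; the library norm on a product is the max norm *)
Definition Ep : Type := (X * Lp_history)%type.

HB.instance Definition _ := GRing.Lmodule.copy Ep (X * Lp_history)%type.

Let normE (x : Ep) : R := `|x.1| + `|x.2|.

Let ler_normED x y : normE (x + y) <= normE x + normE y.
Proof. by rewrite /normE addrACA lerD// ler_normD. Qed.

Let normEZ a x : normE (a *: x) = `|a| * normE x.
Proof. by rewrite /normE/= !normrZ mulrDr. Qed.

Let normE0 x : normE x = 0 -> x = 0.
Proof.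
move=> /eqP; rewrite paddr_eq0// !normr_eq0 => /andP[/eqP x1 /eqP x2].
by case: x x1 x2 => u r /= -> ->.
Qed.

HB.instance Definition _ := Lmodule_isNormed.Build R Ep ler_normED normEZ normE0.

Lemma Ep_normE (x : Ep) : `|x| = `|x.1| + `|x.2|.
Proof. by []. Qed.

Definition transport_dom : set Ep := [set x | W1p x.2 /\ trace0 x.2 x.1].

Definition transport (x : Ep) : Ep := (0, deriv_sigma x.2).

End transport.

Arguments Ep {R} X tau {p} p1.
Arguments transport_dom {R} X tau {p} p1 _.
Arguments transport {R} X tau {p} p1 _.

Section resolvent_error.
Context {R : realType} (X : normedModType R) (tau p : R) (p1 : 1 < p).
Local Notation E := (Ep X tau p1).
Local Notation C := (transport X tau p1).
Local Notation domC := (transport_dom X tau p1).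

(* the norms of D(C), D(C^2) and Y_theta = (D(C), D(C^2))_{theta,1} *)
Definition norm_DC : E -> \bar R := graph_norm domC C.

Definition norm_DC2 : E -> \bar R := graph_norm2 domC C.

Definition norm_Y (theta : R) : E -> \bar R :=
  interpolation_norm1 norm_DC norm_DC2 theta.

(* D t is only meaningful on D(C). *)
Variable D : R -> E -> E.

Definition S_C (h : R) : E -> E := resolvent domC C h.

Definition H_op (h t : R) (x : E) : E := h *: D t (S_C h x).

(* P_h(t) = (I - H_h(t))^-1 S_h^C *)
Definition P_op (h t : R) (x : E) : E :=
  inverse_on setT (fun y => y - H_op h t y) (S_C h x).

Definition perturbed (t : R) (x : E) : E := C x + D t x.

Definition R_op (h t : R) : E -> E := resolvent domC (perturbed t) h.

Definition E_op (h t : R) (x : E) : E := R_op h t x - P_op h t x.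

End resolvent_error.

Arguments norm_DC {R} X tau {p} p1 _.
Arguments norm_DC2 {R} X tau {p} p1 _.
Arguments norm_Y {R} X tau {p} p1 theta _.

(* Main.v *)
(* Since I - hC is a bijection with linear inverse, C is linear on D(C) (no
   uniqueness of weak derivatives is used) and the errors E_h are linear.
   Splitting x = a + b, the two assumed bounds give
   |E_h x| <= K h (|a|_{D(C)} + s |b|_{D(C^2)}) for every s >= h, hence
   |E_h x| / (K h) is a lower bound of the K-functional K(s, x) on [h, 2h], and
   the interpolation norm of x is at least
   h (2h)^{-(1+theta)} |E_h x| / (K h). *)
Require Import Defs.
From HB Require Import structures.
From mathcomp Require Import all_boot all_order all_algebra.
From mathcomp Require Import all_classical all_reals all_analysis.
Import Order.TTheory GRing.Theory Num.Theory.
Import numFieldTopology.Exports numFieldNormedType.Exports.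
Local Open Scope ring_scope.

(** * Inverses of partial operators: linearity and factorization *)

Section partial_operators.
Context {R : realType} {E : normedModType R}.
Implicit Types (dom : set E) (A B : E -> E) (h : R).

(** Membership of 0 is not built in; it is recovered from any element x of [dom] as -x + x. *)
Definition subspace_set dom :=
  forall (a : R) x y, dom x -> dom y -> dom (a *: x + y).

Lemma subspace_setZ dom (a : R) x : subspace_set dom -> dom x -> dom (a *: x).
Proof.
move=> domL dx; have d0 : dom 0 by rewrite -(addNr x) -scaleN1r; exact: domL.
by rewrite -[_ *: _]addr0; exact: domL.
Qed.

Lemma linear_onZ dom A (a : R) x : subspace_set dom -> linear_on dom A ->
  dom x -> A (a *: x) = a *: A x.
Proof.
move=> domL AL dx; have d0 : dom 0 by rewrite -(scale0r x); exact: subspace_setZ.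
have A0 : A 0 = 0.
  have := AL 1 0 0 d0 d0; rewrite !scale1r addr0 => /eqP.
  by rewrite -subr_eq0 opprD addrA subrr sub0r oppr_eq0 => /eqP.
by rewrite -[a *: x]addr0 AL// A0 addr0.
Qed.

Lemma inverse_onP dom A y : set_bij dom setT A ->
  dom (inverse_on dom A y) /\ A (inverse_on dom A y) = y.
Proof.
move=> [_ _ surjA]; have [x dx <-] := surjA y I.
by apply: (@xgetPex _ 0 [set z | dom z /\ A z = A x]%classic); exists x.
Qed.

Lemma inverse_onK dom A x : set_bij dom setT A -> dom x ->
  inverse_on dom A (A x) = x.
Proof.
move=> bijA dx; have [dz Az] := inverse_onP _ _ (A x) bijA.
by case: bijA => _ injA _; apply: injA => //; rewrite inE.
Qed.

Lemma inverse_on_linear dom A : subspace_set dom -> linear_on dom A ->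
  set_bij dom setT A -> linear (inverse_on dom A).
Proof.
move=> domL AL bijA a y z.
have [dy Ay] := inverse_onP _ _ y bijA; have [dz Az] := inverse_onP _ _ z bijA.
rewrite -{1}Ay -{1}Az -AL// inverse_onK//; exact: domL.
Qed.

(** The inverse sends a A x + A y to a x + y by linearity, so this vector lies in [dom], and
    applying A to it returns a A x + A y. *)
Lemma linear_inverse_on dom A : set_bij dom setT A ->
  linear (inverse_on dom A) -> subspace_set dom /\ linear_on dom A.
Proof.
move=> bijA AL.
have invL a x y : dom x -> dom y ->
    inverse_on dom A (a *: A x + A y) = a *: x + y.
  by move=> dx dy; rewrite AL !inverse_onK.
by split=> a x y dx dy; rewrite -invL//;
  have [] := inverse_onP _ _ (a *: A x + A y) bijA.
Qed.

Lemma resolvent_exists_linear dom A h : h != 0 -> resolvent_exists dom A h ->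
  subspace_set dom /\ linear_on dom A.
Proof.
move=> h0 [bijA [RL _]]; have [domL AL] := linear_inverse_on _ _ bijA RL.
split=> // a x y dx dy; apply: (scalerI h0).
(* In the linearity of I - hA the identity parts cancel, leaving h times the linearity of A. *)
have := AL a x y dx dy; rewrite scalerBr addrACA -opprD => /addrI /oppr_inj ->.
by rewrite scalerDr !scalerA mulrC.
Qed.

(* (I - hBS)(I - hA) = I - h(A + B) on the domain, S being the inverse of
   I - hA: invertibility of I - hBS needs no Neumann series. *)
Lemma set_bij_resolvent dom A B h :
  set_bij dom setT (fun x => x - h *: A x) ->
  set_bij dom setT (fun x => x - h *: (A x + B x)) ->
  set_bij setT setT (fun y => y - h *: B (resolvent dom A h y)).
Proof.
move=> bijA [_ injAB surjAB]; pose S := resolvent dom A h.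
have factor y : y - h *: B (S y) = S y - h *: (A (S y) + B (S y)).
  have [_ yE] := inverse_onP _ _ y bijA.
  by rewrite -{1}yE scalerDr opprD addrA.
have domS y : dom (S y) by have [] := inverse_onP _ _ y bijA.
split=> // [y z _ _ /=|z _].
  rewrite -/S !factor => /injAB; rewrite !inE => /(_ (domS y) (domS z)) Syz.
  have [_ <-] := inverse_onP _ _ y bijA; have [_ <-] := inverse_onP _ _ z bijA.
  by rewrite -![inverse_on _ _ _]/(S _) Syz.
have [x dx <-] := surjAB z I; exists (x - h *: A x) => //=.
by rewrite -/S factor /S /resolvent inverse_onK.
Qed.

End partial_operators.

(** * Operator bounds on real interpolation spaces *)

Section interpolation.
Context {R : realType} {E : normedModType R}.
Implicit Types (N : E -> \bar R) (A : E -> E) (dom : set E).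

(** Common ground of the two graph norms: both properties also make sense where N is +oo, off the
    subspace. *)
Definition stronger_norm N := (forall x, `|x|%:E <= N x)%E /\
  (forall (a : R) x, (0 < a)%R -> N (a *: x) <= a%:E * N x)%E.

Lemma stronger_norm_ge0 N x : stronger_norm N -> (0 <= N x)%E.
Proof. by move=> [Nx _]; apply: le_trans (Nx x); rewrite lee_fin. Qed.

Lemma graph_norm_stronger dom A : subspace_set dom -> linear_on dom A ->
  stronger_norm (graph_norm dom A).
Proof.
move=> domL AL; split=> [x|a x a0]; rewrite /graph_norm.
  by case: asboolP => _; rewrite ?leey// lee_fin lerDl.
have [dx|_] := asboolP (dom x); last by rewrite gt0_muley ?lte_fin// leey.
rewrite asboolT; last exact: subspace_setZ.
by rewrite (linear_onZ dom)// !normrZ gtr0_norm// -mulrDr EFinM.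
Qed.

Lemma graph_norm2_stronger dom A : subspace_set dom -> linear_on dom A ->
  stronger_norm (graph_norm2 dom A).
Proof.
move=> domL AL; split=> [x|a x a0]; rewrite /graph_norm2.
  by case: asboolP => _; rewrite ?leey// lee_fin -addrA lerDl addr_ge0.
have [[dx dAx]|_] := asboolP (domain2 dom A x); last first.
  by rewrite gt0_muley ?lte_fin// leey.
have AaE : A (a *: x) = a *: A x by exact: (linear_onZ dom).
rewrite asboolT; last by split; rewrite ?AaE; exact: subspace_setZ.
by rewrite AaE (linear_onZ dom)// !normrZ gtr0_norm// -!mulrDr EFinM.
Qed.

Lemma le_opnorm N A (c : R) x : stronger_norm N -> linear A -> 0 < c ->
  (opnorm N A <= c%:E)%E -> (`|A x|%:E <= c%:E * N x)%E.
Proof.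
move=> NN AL c0 Ac; have := stronger_norm_ge0 _ x NN; have [leN NZ] := NN.
have AZ a y : A (a *: y) = a *: A y.
  by apply: (linear_onZ setT) => // b u v _ _; exact: AL.
(* If N x = +oo, the right side is +oo because c > 0. If N x = 0, then x = 0 since N dominates the
   ambient norm. Otherwise x / N x lies in the unit ball. *)
case NxE : (N x) => [r| |] // r0; last by rewrite gt0_muley ?lte_fin// leey.
move: r0; rewrite lee_fin le_eqVlt => /predU1P[r0|r0].
  have x0 : x = 0.
    by apply/eqP; rewrite -normr_le0 -lee_fin r0 -NxE.
  by rewrite x0 -(scale0r (0 : E)) AZ scale0r normr0 -r0 mule0.
have Nx1 : (N (r^-1 *: x) <= 1)%E.
  apply: le_trans (NZ _ _ _) _; first by rewrite invr_gt0.
  by rewrite NxE -EFinM mulVf ?gt_eqF.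
have : (`|A (r^-1 *: x)|%:E <= c%:E)%E.
  by apply: le_trans Ac; apply: ereal_sup_ubound; exists (r^-1 *: x).
rewrite AZ normrZ gtr0_norm ?invr_gt0// -EFinM !lee_fin mulrC.
by rewrite ler_pdivrMr.
Qed.

(* The K-functional is never shown to be measurable; monotonicity still holds
   because the integral of a nonnegative function is a supremum over the simple
   functions below it. *)
Lemma ge0_le_integral_nonmeasurable {d} {T : measurableType d}
    (mu : {measure set T -> \bar R}) (A : set T) (f g : T -> \bar R) :
  (forall x, A x -> 0 <= f x)%E -> (forall x, A x -> f x <= g x)%E ->
  (\int[mu]_(x in A) f x <= \int[mu]_(x in A) g x)%E.
Proof.
move=> f0 fg; rewrite !ge0_integralE//; last first.
  by move=> x Ax; exact: le_trans (f0 x Ax) (fg x Ax).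
apply: ereal_sup_le => _ [k kf <-]; exists k => // x.
by apply: le_trans (kf x) _; exact: lee_restrict.
Qed.

(** Comparison with c times the indicator of [a, b], an interval inside the half-line because a >
    0. *)
Lemma integral_ge_const (f : R -> \bar R) (a b c : R) : 0 < a -> a < b ->
  0 <= c -> (forall s, (0 < s)%R -> 0 <= f s)%E ->
  (forall s, (a <= s <= b)%R -> c%:E <= f s)%E ->
  ((c * (b - a))%:E <= \int[lebesgue_measure]_(s in `]0%R, +oo[) f s)%E.
Proof.
move=> a0 ab c0 f0 fc.
have abD : (`]0, +oo[ `&` `[a, b])%classic = `[a, b]%classic :> set R.
  apply: setIidr => s /=; rewrite !in_itv/= andbT => /andP[as_ _].
  exact: lt_le_trans a0 as_.
have -> : (c * (b - a))%:E = (\int[lebesgue_measure]_(s in `]0%R, +oo[)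
    ((cst c%:E \_ `[a, b]) s))%E.
  rewrite -integral_mkcondr abD integral_cst//= lebesgue_measure_itv/=.
  by rewrite lte_fin ab -EFinB EFinM.
apply: ge0_le_integral_nonmeasurable => [s _|s /=].
  by apply: erestrict_ge0 => ? _; rewrite lee_fin.
rewrite in_itv/= andbT patchE => s0.
by case: ifPn => [|_]; [rewrite inE/= in_itv/= => /fc | exact: f0].
Qed.

Lemma K_functional_ge0 N0 N1 (s : R) x : stronger_norm N0 -> stronger_norm N1 ->
  0 <= s -> (0 <= K_functional N0 N1 s x)%E.
Proof.
move=> N0N N1N s0; apply: le_ereal_inf_tmp => _ [[a b] _ <-] /=.
by rewrite adde_ge0 ?mule_ge0 ?lee_fin ?stronger_norm_ge0.
Qed.

Lemma opnorm_K_functional N0 N1 A (K h s : R) x :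
  stronger_norm N0 -> stronger_norm N1 -> linear A -> 0 < K -> 0 < h <= s ->
  (opnorm N0 A <= (K * h)%:E)%E -> (opnorm N1 A <= (K * h ^+ 2)%:E)%E ->
  ((`|A x| / (K * h))%:E <= K_functional N0 N1 s x)%E.
Proof.
move=> N0N N1N AL K0 /andP[h0 hs] A0 A1.
have Kh0 : 0 < K * h by rewrite mulr_gt0.
apply: le_ereal_inf_tmp => _ [[a b] /= abx <-].
rewrite mulrC EFinM lee_pdivrMl// -abx.
have -> : A (a + b) = A a + A b by rewrite -[a]scale1r AL !scale1r.
apply: (@le_trans _ _ (`|A a|%:E + `|A b|%:E)%E).
  by rewrite -EFinD lee_fin ler_normD.
rewrite muleDr; last 2 first.
- by [].
- apply: ge0_adde_def; rewrite inE ?mule_ge0 ?stronger_norm_ge0//.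
  by rewrite lee_fin (le_trans _ hs)// ltW.
apply: leeD; first exact: le_opnorm.
apply: (@le_trans _ _ ((K * h ^+ 2)%:E * N1 b)%E).
  by apply: le_opnorm => //; rewrite mulr_gt0 ?exprn_gt0.
(* One factor of h ^ 2 stays in K h, the other is at most s. *)
rewrite muleA; apply: lee_wpmul2r; first exact: stronger_norm_ge0.
by rewrite -EFinM lee_fin expr2 mulrA ler_wpM2l ?(ltW Kh0).
Qed.

Lemma opnorm_interpolation_norm1 N0 N1 A (theta K h : R) :
  stronger_norm N0 -> stronger_norm N1 -> linear A ->
  0 <= theta -> 0 < K -> 0 < h ->
  (opnorm N0 A <= (K * h)%:E)%E -> (opnorm N1 A <= (K * h ^+ 2)%:E)%E ->
  (opnorm (interpolation_norm1 N0 N1 theta) A <=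
    (K * 2 `^ (1 + theta) * h `^ (1 + theta))%:E)%E.
Proof.
move=> N0N N1N AL t0 K0 h0 A0 A1.
have Kh0 : 0 < K * h by rewrite mulr_gt0.
apply: ge_ereal_sup => _ [x /= Nx1 <-]; rewrite lee_fin.
set c := `|A x| / (K * h).
have c0 : 0 <= c by rewrite divr_ge0// ltW.
have h20 : 0 < 2 * h by rewrite mulr_gt0.
(* The maximum of s ^ (1 + theta) on [h, 2h], so that c / w bounds the integrand from below
   there. *)
pose w := (2 * h) `^ (1 + theta).
have w0 : 0 < w by rewrite powR_gt0.
have : ((c / w * (2 * h - h))%:E <= interpolation_norm1 N0 N1 theta x)%E.
  apply: integral_ge_const => //.
  - by rewrite ltr_pMl// ltr1n.
  - by rewrite divr_ge0// ltW.
  - move=> s s0; rewrite !mule_ge0 ?lee_fin ?powR_ge0 ?invr_ge0 ?(ltW s0)//.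
    by apply: K_functional_ge0; rewrite ?ltW.
  - move=> s /andP[hs s2h]; have s0 := lt_le_trans h0 hs.
    have cK : (c%:E <= K_functional N0 N1 s x)%E.
      by apply: opnorm_K_functional => //; rewrite h0.
    (* The weights s ^ (- theta) and 1 / s merge into s ^ -(1 + theta), which is at least 1 / w. *)
    rewrite muleAC -EFinM -(powR_inv1 (ltW s0)) -powRD; last first.
      by rewrite (gt_eqF s0) implybT.
    rewrite -opprD addrC powRN mulrC EFinM.
    apply: lee_pmul; rewrite ?lee_fin ?invr_ge0 ?(ltW w0)//.
    rewrite lef_pV2 ?posrE ?powR_gt0// ge0_ler_powR ?nnegrE ?(ltW s0)//.
      by rewrite addr_ge0.
    exact: ltW.
(* The interval has length h, so c h / w <= 1, that is |A x| <= K w. *)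
move=> /le_trans /(_ Nx1).
rewrite lee_fin mulrDl mul1r addrK mulrAC ler_pdivrMr// mul1r.
rewrite /c /w powRM ?(ltW h0)// invfM mulrA mulfVK ?gt_eqF//.
by rewrite ler_pdivrMr// [leRHS]mulrC mulrA.
Qed.

End interpolation.

(** * Linearity of the errors and the interpolated bound *)

Theorem corollary4p8 (R : realType) (X : completeNormedModType R)
  (tau T p : R) (tau0 : tau < 0) (T0 : 0 < T) (p1 : 1 < p)
  (D : R -> Ep X tau p1 -> Ep X tau p1)
  (D_linear : forall t, 0 <= t <= T -> linear_on (transport_dom X tau p1) (D t))
  (S_exists : forall h, 0 < h ->
    resolvent_exists (transport_dom X tau p1) (transport X tau p1) h)
  (h0 q : R) (h0_gt0 : 0 < h0) (q01 : 0 < q < 1)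
  (H_small : forall t h, 0 <= t <= T -> 0 < h <= h0 ->
    (opnorm (@ambient_norm R (Ep X tau p1)) (H_op D h t) <= q%:E)%E)
  (R_exists : forall t h, 0 <= t <= T -> 0 < h <= h0 ->
    resolvent_exists (transport_dom X tau p1) (perturbed D t) h)
  (theta t : R) (theta01 : 0 < theta < 1) (t0T : 0 <= t <= T) :
  (exists2 K : R, 0 < K & forall h, 0 < h <= h0 ->
    (opnorm (norm_DC X tau p1) (E_op D h t) <= (K * h)%:E)%E /\
    (opnorm (norm_DC2 X tau p1) (E_op D h t) <= (K * h ^+ 2)%:E)%E) ->
  exists2 K' : R, 0 < K' & forall h, 0 < h <= h0 ->
    (opnorm (norm_Y X tau p1 theta) (E_op D h t) <= (K' * h `^ (1 + theta))%:E)%E.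
Proof.
move=> [K K0 EK]; have /andP[/ltW t0 _] := theta01.
exists (K * 2 `^ (1 + theta)); first by rewrite mulr_gt0 ?powR_gt0.
move=> h hh0; have [E1 E2] := EK h hh0; have /andP[h_gt0 _] := hh0.
have [bijS [SL _]] := S_exists h h_gt0.
have [bijR [RL _]] := R_exists t h t0T hh0.
have [domL CL] := resolvent_exists_linear _ _ _ (lt0r_neq0 h_gt0)
  (S_exists h h_gt0).
have domS y : transport_dom X tau p1 (S_C h y).
  by have [] := inverse_onP _ _ y bijS.
(* D(t) is linear only on D(C), which is where [S_C] takes its values. *)
have HL : linear_on setT (fun y => y - H_op D h t y).
  move=> a x y _ _; rewrite /H_op [S_C h _]SL D_linear//; try exact: domS.
  by rewrite scalerBr scalerDr opprD addrACA !scalerA mulrC.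
have PL : linear (P_op D h t).
  move=> a x y; rewrite /P_op [S_C h _]SL.
  apply: (@inverse_on_linear _ _ setT) => //.
  (* [perturbed] unfolds to C + D(t), so the bijectivity of I - hC and of I - h(C + D(t)) yields
     that of I - H_h(t). *)
  exact: (set_bij_resolvent _ _ _ _ bijS bijR).
have EL : linear (E_op D h t).
  move=> a x y; rewrite /E_op PL [R_op _ _ _ _]RL.
  by rewrite scalerBr opprD addrACA.
apply: opnorm_interpolation_norm1 => //.
  exact: graph_norm_stronger.
exact: graph_norm2_stronger.
Qed.
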